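(* Let $\hat\beta$ be the Lasso estimator with tuning parameter $\lambda>0$, and for each $j=1,\dots,p$ let $\hat\gamma_j$ be obtained by the square root Lasso of $X_j$ on $X_{-j}$ with common tuning parameter $\lambda_0>0$, with associated matrices $\hat C,\hat\Theta,\hat T,\tilde T$ (all defined in the context). Let $\lambda_\epsilon\ge 0$ and $$\mathcal T_{\rm all}:=\{\|\epsilon^TX\hat C\hat T^{-1}\|_\infty/n\le\lambda_\epsilon\}.$$ Then on $\mathcal T_{\rm all}$ $$\|\hat\beta-\beta^0\|_\infty\le(\lambda_\epsilon+\lambda_0\|\hat\beta-\beta^0\|_1)\,\|\tilde T^{-2}\hat T\|_\infty+\lambda\,|||\hat\Theta|||_1$$ and $$\|\hat T^{-1}\tilde T^2(\hat\beta-\beta^0)\|_\infty\le\lambda_\epsilon+\lambda_0\|\hat\beta-\beta^0\|_1+\lambda\,|||\hat C\hat T^{-1}|||_1 .$$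
   Context: Linear model with fixed design: $Y=X\beta^0+\epsilon$, with $X$ a fixed $n\times p$ real matrix with columns $X_1,\dots,X_p$, $\beta^0\in\mathbb R^p$, $\epsilon\in\mathbb R^n$ a noise vector. For $v\in\mathbb R^n$, $\|v\|_n^2:=v^Tv/n$. The Lasso estimator is a minimizer $\hat\beta\in\arg\min_{\beta\in\mathbb R^p}\{\|Y-X\beta\|_n^2+2\lambda\|\beta\|_1\}$. For each $j$, $X_{-j}$ is $X$ without its $j$-th column, and the square root Lasso is $\hat\gamma_j\in\arg\min_{\gamma\in\mathbb R^{p-1}}\{\|X_j-X_{-j}\gamma\|_n+\lambda_0\|\gamma\|_1\}$ (entries $\hat\gamma_{k,j}$, $k\ne j$). Put $\hat\tau_j:=\|X_j-X_{-j}\hat\gamma_j\|_n$ (assumed positive for every $j$), $\lambda_j:=\lambda_0\hat\tau_j$, $\tilde\tau_j^2:=\hat\tau_j^2+\lambda_j\|\hat\gamma_j\|_1$, $\hat c_j\in\mathbb R^p$ with $j$-th entry $1$ and $k$-th entry $-\hat\gamma_{k,j}$ for $k\ne j$, and $\hat\theta_j:=\hat c_j/\tilde\tau_j^2$. Define $\hat C:=(\hat c_1,\dots,\hat c_p)$, $\hat\Theta:=(\hat\theta_1,\dots,\hat\theta_p)$ (columns), $\hat T:={\rm diag}(\hat\tau_1,\dots,\hat\tau_p)$, $\tilde T:={\rm diag}(\tilde\tau_1,\dots,\tilde\tau_p)$. For a matrix $A$, $|||A|||_1:=\max_j\sum_k|A_{k,j}|$ and $\|A\|_\infty:=\max_{k,j}|A_{k,j}|$.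 ''On an event'' means that the inequality holds whenever the inequality defining the event holds. *)

(* Defs.v *)
From mathcomp Require Import all_boot all_order all_algebra.
From mathcomp Require Import reals normedtype.

Set Implicit Arguments.
Unset Strict Implicit.
Unset Printing Implicit Defensive.

Import Order.TTheory GRing.Theory Num.Theory.
Local Open Scope ring_scope.

(* The entrywise maximum norm of a matrix is the library's [mx_norm]. *)

Section Norms.
Context {R : realType}.

Definition emp_norm_sq n (v : 'cV[R]_n) : R := (v^T *m v) 0 0 / n%:R.

Definition emp_norm n (v : 'cV[R]_n) : R := Num.sqrt (emp_norm_sq v).

Definition l1norm p (v : 'cV[R]_p) : R := \sum_k `|v k 0|.

Definition max_col_l1norm m p (A : 'M[R]_(m, p)) : R :=
  \big[Num.max/0]_j l1norm (col j A).

Definition is_argmin (T : Type) (f : T -> R) (x : T) : Prop :=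
  forall y, f x <= f y.

End Norms.

Section Estimators.
Context {R : realType} {n p : nat}.
Variable X : 'M[R]_(n, p).

Definition lasso_objective (Y : 'cV[R]_n) (lambda : R) (b : 'cV[R]_p) : R :=
  emp_norm_sq (Y - X *m b) + 2%:R * lambda * l1norm b.

Definition is_lasso (Y : 'cV[R]_n) (lambda : R) (b : 'cV[R]_p) : Prop :=
  is_argmin (lasso_objective Y lambda) b.

(* [col' j X] is X without column j; its k-th column is column [lift j k] of X,
   so entry k of the coefficient vector g belongs to the index [lift j k]. *)
Definition sqrt_lasso_objective (lambda0 : R) (j : 'I_p) (g : 'cV[R]_p.-1) : R :=
  emp_norm (col j X - col' j X *m g) + lambda0 * l1norm g.

Definition is_sqrt_lasso (lambda0 : R) (j : 'I_p) (g : 'cV[R]_p.-1) : Prop :=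
  is_argmin (sqrt_lasso_objective lambda0 j) g.

Variable gamma : 'I_p -> 'cV[R]_p.-1.

Definition tau_hat (j : 'I_p) : R :=
  emp_norm (col j X - col' j X *m gamma j).

Definition lambda_node (lambda0 : R) (j : 'I_p) : R := lambda0 * tau_hat j.

Definition tau_tilde_sq (lambda0 : R) (j : 'I_p) : R :=
  tau_hat j ^+ 2 + lambda_node lambda0 j * l1norm (gamma j).

Definition tau_tilde (lambda0 : R) (j : 'I_p) : R :=
  Num.sqrt (tau_tilde_sq lambda0 j).

Definition c_hat (j : 'I_p) : 'cV[R]_p :=
  \col_k (if unlift j k is Some k' then - gamma j k' 0 else 1).

Definition theta_hat (lambda0 : R) (j : 'I_p) : 'cV[R]_p :=
  (tau_tilde_sq lambda0 j)^-1 *: c_hat j.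

Definition C_hat : 'M[R]_p := \matrix_(k, j) c_hat j k 0.

Definition Theta_hat (lambda0 : R) : 'M[R]_p :=
  \matrix_(k, j) theta_hat lambda0 j k 0.

Definition T_hat : 'M[R]_p := diag_mx (\row_j tau_hat j).

Definition T_tilde (lambda0 : R) : 'M[R]_p :=
  diag_mx (\row_j tau_tilde lambda0 j).

End Estimators.

(* Main.v *)
(* A square root Lasso solution gamma_j is also a Lasso solution with tuning
   parameter lambda0 tau_j, so both estimators obey the Lasso optimality conditions.
   For the nodewise regressions these say that the inner product of X c_j with
   column j is tilde tau_j^2 and with any other column is at most lambda0 tau_j.
   Since eps = (Y - X beta) + X (beta - beta0), pairing eps with X c_j isolates
   tilde tau_j^2 (beta - beta0)_j; the remaining coordinates are bounded by these
   conditions, and the residual Y - X beta by those of the Lasso. *)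

Require Import Defs.
From mathcomp Require Import all_boot all_order all_algebra.
From mathcomp Require Import reals normedtype.
From mathcomp Require Import ring lra.

Import Order.TTheory GRing.Theory Num.Theory.
Local Open Scope ring_scope.

(** * Empirical inner product and expansion of the squared norm along a line *)

Section EmpiricalInnerProduct.
Context {R : realType} {n : nat}.
Implicit Types (u v w : 'cV[R]_n) (t : R).

Definition emp_dot u v : R := (u^T *m v) 0 0 / n%:R.

Lemma emp_dotE u v : emp_dot u v = (\sum_i u i 0 * v i 0) / n%:R.
Proof. by rewrite /emp_dot mxE; under eq_bigr do rewrite mxE. Qed.

Lemma emp_dotC u v : emp_dot u v = emp_dot v u.
Proof. by rewrite !emp_dotE; under eq_bigr do rewrite mulrC. Qed.

Lemma emp_dotDl u v w : emp_dot (u + v) w = emp_dot u w + emp_dot v w.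
Proof. by rewrite /emp_dot linearD mulmxDl mxE mulrDl. Qed.

Lemma emp_dotDr u v w : emp_dot w (u + v) = emp_dot w u + emp_dot w v.
Proof. by rewrite !(emp_dotC w) emp_dotDl. Qed.

Lemma emp_dotZl t u v : emp_dot (t *: u) v = t * emp_dot u v.
Proof. by rewrite /emp_dot linearZ -scalemxAl mxE mulrA. Qed.

Lemma emp_dotZr t u v : emp_dot u (t *: v) = t * emp_dot u v.
Proof. by rewrite !(emp_dotC u) emp_dotZl. Qed.

Lemma emp_norm_sqE u : emp_norm_sq u = emp_dot u u.
Proof. by []. Qed.

Lemma emp_norm_sq_ge0 u : 0 <= emp_norm_sq u.
Proof.
rewrite emp_norm_sqE emp_dotE divr_ge0 ?ler0n//.
by apply: sumr_ge0 => i _; rewrite -expr2 sqr_ge0.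
Qed.

Lemma sqr_emp_norm u : emp_norm u ^+ 2 = emp_norm_sq u.
Proof. by rewrite sqr_sqrtr ?emp_norm_sq_ge0. Qed.

Lemma emp_norm_sqDZ u v t :
  emp_norm_sq (u + t *: v)
    = emp_norm_sq u + 2%:R * t * emp_dot v u + t ^+ 2 * emp_norm_sq v.
Proof.
rewrite !emp_norm_sqE !(emp_dotDl, emp_dotDr, emp_dotZl, emp_dotZr).
rewrite (emp_dotC u v); ring.
Qed.

End EmpiricalInnerProduct.

(** * The l1 norm: scaling, triangle inequality, splitting off a coordinate *)

Section L1Norm.
Context {R : realType} {p : nat}.
Implicit Types b d : 'cV[R]_p.

Lemma l1norm_ge0 b : 0 <= l1norm b.
Proof. exact: sumr_ge0. Qed.

Lemma l1normZ (t : R) b : l1norm (t *: b) = `|t| * l1norm b.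
Proof.
by rewrite /l1norm mulr_sumr; apply: eq_bigr => k _; rewrite mxE normrM.
Qed.

Lemma l1normD b d : l1norm (b + d) <= l1norm b + l1norm d.
Proof.
by rewrite /l1norm -big_split/=; apply: ler_sum => k _; rewrite mxE ler_normD.
Qed.

Lemma l1norm_delta (k : 'I_p) : l1norm (delta_mx k 0 : 'cV[R]_p) = 1.
Proof.
rewrite /l1norm (bigD1 k)//= big1 => [|i ik].
  by rewrite mxE !eqxx normr1 addr0.
by rewrite mxE (negbTE ik) normr0.
Qed.

Lemma l1norm_row' (j : 'I_p) b : l1norm b = `|b j 0| + l1norm (row' j b).
Proof.
rewrite /l1norm (bigD1_ord j)//=; congr (_ + _).
by apply: eq_bigr => k _; rewrite mxE.
Qed.

End L1Norm.

(** * Pairing linear combinations of the columns with a fixed vector *)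

Lemma emp_dot_mulmx (R : realType) n p (X : 'M[R]_(n, p)) (b : 'cV[R]_p) (r : 'cV[R]_n) :
  emp_dot (X *m b) r = \sum_k b k 0 * emp_dot (col k X) r.
Proof.
rewrite emp_dotE; under eq_bigr do rewrite mxE mulr_suml.
rewrite exchange_big/= mulr_suml; apply: eq_bigr => k _.
rewrite emp_dotE mulrA; congr (_ / _); rewrite mulr_sumr.
by apply: eq_bigr => i _; rewrite mxE; ring.
Qed.

Lemma emp_dot_mulmx_col' (R : realType) n p (X : 'M[R]_(n, p)) (j : 'I_p)
    (b : 'cV[R]_p) (r : 'cV[R]_n) :
  emp_dot (X *m b) r
    = b j 0 * emp_dot (col j X) r + emp_dot (col' j X *m row' j b) r.
Proof.
rewrite !emp_dot_mulmx (bigD1_ord j)//=; congr (_ + _).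
apply: eq_bigr => k _; rewrite mxE; congr (_ * emp_dot _ _).
by apply/colP => i; rewrite !mxE.
Qed.

Lemma emp_dot_mulmx_le (R : realType) n p (X : 'M[R]_(n, p)) (b : 'cV[R]_p)
    (r : 'cV[R]_n) (m : R) :
  (forall k, `|emp_dot (col k X) r| <= m) ->
  `|emp_dot (X *m b) r| <= m * l1norm b.
Proof.
move=> Xr_le; rewrite emp_dot_mulmx (le_trans (ler_norm_sum _ _ _))//.
rewrite /l1norm mulr_sumr; apply: ler_sum => k _.
by rewrite normrM mulrC ler_wpM2r.
Qed.

(** Divide by [t] and let [t] tend to 0. This turns minimality along a ray into a first-order
    condition without derivatives. *)
Lemma le0_of_linear_le_quadratic (R : realFieldType) (g a : R) :
  (forall t, 0 < t <= 1 -> t * g <= t ^+ 2 * a) -> g <= 0.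
Proof.
move=> gP; rewrite leNgt; apply/negP => g0.
have d0 : 0 < g + `|a| by rewrite ltr_pwDl.
(* This [t] is at most 1/2 and gives [t * |a| < g / 2], contradicting [g <= t * a]; the absolute
   value keeps the denominator positive for either sign of [a]. *)
pose t := g / (2%:R * (g + `|a|)).
have t0 : 0 < t by rewrite divr_gt0// mulr_gt0.
have tE : t * (2%:R * (g + `|a|)) = g by rewrite divfK// mulf_neq0// gt_eqF.
have a0 : 0 <= `|a| by [].
have t1 : t <= 1 by rewrite ler_pdivrMr ?mulr_gt0//; lra.
have := gP t; rewrite t0 t1 expr2 -mulrA ler_pM2l// => /(_ isT).
have := ler_wpM2l (ltW t0) (ler_norm a).
by nra.
Qed.

(** * First-order optimality conditions of the Lasso *)

Section LassoOptimality.
Context {R : realType} {n p : nat}.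
Variables (X : 'M[R]_(n, p)) (Y : 'cV[R]_n) (lambda : R) (b : 'cV[R]_p).
Hypotheses (lambda_ge0 : 0 <= lambda) (b_lasso : is_lasso X Y lambda b).

(* [m] plays the role of the one-sided derivative of the l1 norm at [b] in the
   direction [d]. *)
Lemma lasso_directional_bound (d : 'cV[R]_p) (m : R) :
  (forall t, 0 < t <= 1 -> l1norm (b + t *: d) <= l1norm b + t * m) ->
  emp_dot (X *m d) (Y - X *m b) <= lambda * m.
Proof.
move=> dm; rewrite -subr_le0.
(* Half the squared norm, because the linear term of the expanded loss and the penalty both carry a
   factor 2. *)
apply: (le0_of_linear_le_quadratic _ _ (emp_norm_sq (X *m d) / 2%:R)) => t t01.
have := b_lasso (b + t *: d); rewrite /lasso_objective.
have -> : Y - X *m (b + t *: d) = (Y - X *m b) + (- t) *: (X *m d).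
  by rewrite mulmxDr -scalemxAr scaleNr opprD addrA.
rewrite emp_norm_sqDZ sqrrN.
have := ler_wpM2l lambda_ge0 (dm t t01).
by move=> ? ?; nra.
Qed.

(** Perturb along plus and minus the [k]-th unit vector, where the triangle inequality allows slope
    1. *)
Lemma lasso_col_bound (k : 'I_p) : `|emp_dot (col k X) (Y - X *m b)| <= lambda.
Proof.
have step (s : R) : `|s| = 1 -> s * emp_dot (col k X) (Y - X *m b) <= lambda.
  move=> s1; rewrite -emp_dotZl colE scalemxAr -[leRHS]mulr1.
  apply: lasso_directional_bound => t /andP[t0 _].
  by rewrite (le_trans (l1normD _ _))// !l1normZ l1norm_delta s1 !mulr1 gtr0_norm.
have := step 1 (normr1 _); have := step (- 1) (normrN1 _).
by rewrite ler_norml mulN1r mul1r lerNl => -> ->.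
Qed.

(** Perturb along [b] and [- b]: for [t <= 1] the factor [1 + t * s] is nonnegative, so the l1 norm
    is exactly affine in [t] and the two inequalities combine to an equality. *)
Lemma lasso_fit_eq : emp_dot (X *m b) (Y - X *m b) = lambda * l1norm b.
Proof.
have step (s : R) : `|s| = 1 ->
    s * emp_dot (X *m b) (Y - X *m b) <= lambda * (s * l1norm b).
  move=> s1; rewrite -emp_dotZl scalemxAr.
  apply: lasso_directional_bound => t /andP[t0 t1].
  have s_ge : -1 <= s <= 1 by rewrite -ler_norml s1.
  rewrite scalerA -[X in X + _]scale1r -scalerDl l1normZ ger0_norm; nra.
have := step 1 (normr1 _); have := step (- 1) (normrN1 _).
by move=> ? ?; apply/le_anti/andP; split; nra.
Qed.

End LassoOptimality.

(** * Nodewise regressions and the error bound for one coordinate *)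

Section NodewiseRegression.
Context {R : realType} {n p : nat}.
Variables (X : 'M[R]_(n, p)) (gamma : 'I_p -> 'cV[R]_p.-1) (lambda0 : R).
Variable j : 'I_p.
Hypotheses (lambda0_ge0 : 0 <= lambda0).
Hypothesis gamma_sqrt_lasso : is_sqrt_lasso X lambda0 j (gamma j).

Lemma tau_hat_ge0 : 0 <= tau_hat X gamma j.
Proof. exact: sqrtr_ge0. Qed.

Lemma lambda_node_ge0 : 0 <= lambda_node X gamma lambda0 j.
Proof. by rewrite mulr_ge0// tau_hat_ge0. Qed.

(* The bound [x^2 >= 2 tau x - tau^2], with equality at [x = tau], minorizes the
   Lasso objective by an affine function of the square root Lasso objective. *)
Lemma sqrt_lasso_lasso :
  is_lasso (col' j X) (col j X) (lambda_node X gamma lambda0 j) (gamma j).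
Proof.
move=> g; rewrite /lasso_objective -!sqr_emp_norm /lambda_node.
have := gamma_sqrt_lasso g; rewrite /sqrt_lasso_objective.
rewrite -/(tau_hat X gamma j) => le_obj.
have := ler_wpM2l tau_hat_ge0 le_obj.
have := sqr_ge0 (emp_norm (col j X - col' j X *m g) - tau_hat X gamma j).
by move=> ? ?; nra.
Qed.

Lemma mulmx_c_hat : X *m c_hat gamma j = col j X - col' j X *m gamma j.
Proof.
apply/colP => i; rewrite !mxE (bigD1_ord j)//= !mxE unlift_none mulr1.
congr (_ + _); rewrite -sumrN; apply: eq_bigr => k _.
by rewrite !mxE liftK mulrN.
Qed.

(** Column [j] is residual plus fit: the residual contributes [tau_hat ^+ 2], and the fit
    contributes the penalty term by [lasso_fit_eq]. *)
Lemma emp_dot_col_c_hat :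
  emp_dot (col j X) (X *m c_hat gamma j) = tau_tilde_sq X gamma lambda0 j.
Proof.
rewrite mulmx_c_hat -{1}(subrK (col' j X *m gamma j) (col j X)) emp_dotDl.
rewrite (lasso_fit_eq _ _ _ _ lambda_node_ge0 sqrt_lasso_lasso).
by rewrite /tau_tilde_sq sqr_emp_norm.
Qed.

Lemma emp_dot_col'_c_hat_le (d : 'cV[R]_p.-1) :
  `|emp_dot (col' j X *m d) (X *m c_hat gamma j)|
    <= lambda_node X gamma lambda0 j * l1norm d.
Proof.
rewrite mulmx_c_hat; apply: emp_dot_mulmx_le => k.
exact: lasso_col_bound lambda_node_ge0 sqrt_lasso_lasso k.
Qed.

Lemma tau_tilde_sq_gt0 :
  0 < tau_hat X gamma j -> 0 < tau_tilde_sq X gamma lambda0 j.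
Proof.
move=> t0; rewrite ltr_pwDl ?exprn_gt0//.
by rewrite mulr_ge0 ?lambda_node_ge0 ?l1norm_ge0.
Qed.

(** The bound before any rescaling and for arbitrary noise: dividing it by [tau_tilde_sq] or by
    [tau_hat] leads to the two claims of the theorem. *)
Lemma lasso_error_coord (lambda : R) (Y eps : 'cV[R]_n) (beta0 beta : 'cV[R]_p) :
  Y = X *m beta0 + eps -> 0 <= lambda -> is_lasso X Y lambda beta ->
  tau_tilde_sq X gamma lambda0 j * `|(beta - beta0) j 0|
    <= `|emp_dot (X *m c_hat gamma j) eps|
       + lambda_node X gamma lambda0 j * l1norm (beta - beta0)
       + lambda * l1norm (c_hat gamma j).
Proof.
move=> model lambda_ge0 beta_lasso.
set D := beta - beta0; set c := c_hat gamma j.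
have epsE : eps = (Y - X *m beta) + X *m D.
  by rewrite model mulmxBr addrA subrK addrC addKr.
have dotE : emp_dot (X *m c) eps = emp_dot (X *m c) (Y - X *m beta)
    + D j 0 * tau_tilde_sq X gamma lambda0 j
    + emp_dot (col' j X *m row' j D) (X *m c).
  rewrite epsE emp_dotDr (emp_dotC _ (X *m D)) (emp_dot_mulmx_col' _ _ _ X j D).
  by rewrite emp_dot_col_c_hat addrA.
have res_le : `|emp_dot (X *m c) (Y - X *m beta)| <= lambda * l1norm c.
  by apply: emp_dot_mulmx_le => k; exact: lasso_col_bound.
have off_le : `|emp_dot (col' j X *m row' j D) (X *m c)|
    <= lambda_node X gamma lambda0 j * l1norm D.
  apply: le_trans (emp_dot_col'_c_hat_le _) _.
  by rewrite ler_wpM2l ?lambda_node_ge0// (l1norm_row' j D) lerDr.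
have -> : tau_tilde_sq X gamma lambda0 j * `|D j 0|
    = `|D j 0 * tau_tilde_sq X gamma lambda0 j|.
  rewrite normrM mulrC; congr (_ * _); rewrite ger0_norm//.
  by rewrite addr_ge0 ?sqr_ge0// mulr_ge0 ?lambda_node_ge0 ?l1norm_ge0.
have -> : D j 0 * tau_tilde_sq X gamma lambda0 j
    = emp_dot (X *m c) eps - emp_dot (col' j X *m row' j D) (X *m c)
      - emp_dot (X *m c) (Y - X *m beta) by rewrite dotE; ring.
apply: le_trans (ler_normB _ _) _; apply: lerD => //.
by apply: le_trans (ler_normB _ _) _; apply: lerD.
Qed.

End NodewiseRegression.

(** * Matrix norms as maxima, and inverses of diagonal matrices *)

Section MatrixNorms.
Context {R : realType}.

Lemma le_mx_norm m p (A : 'M[R]_(m, p)) i j : `|A i j| <= mx_norm A.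
Proof.
rewrite mx_normrE.
exact: (le_bigmax _ (fun ij : 'I_m * 'I_p => `|A ij.1 ij.2|) (i, j)).
Qed.

(** The maximum starts from 0, so an empty matrix has norm 0; hence the condition [0 <= x]. *)
Lemma mx_norm_le m p (A : 'M[R]_(m, p)) (x : R) :
  0 <= x -> (forall i j, `|A i j| <= x) -> mx_norm A <= x.
Proof. by move=> x0 Ax; rewrite mx_normrE; apply: bigmax_le => // -[]. Qed.

Lemma mx_norm_ge0 m p (A : 'M[R]_(m, p)) : 0 <= mx_norm A.
Proof. by rewrite mx_normrE bigmax_ge_id. Qed.

Lemma le_max_col_l1norm m p (A : 'M[R]_(m, p)) j :
  l1norm (col j A) <= max_col_l1norm A.
Proof. exact: le_bigmax. Qed.

Lemma max_col_l1norm_ge0 m p (A : 'M[R]_(m, p)) : 0 <= max_col_l1norm A.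
Proof. exact: bigmax_ge_id. Qed.

Lemma invmx_diag_mx p (d : 'rV[R]_p) :
  (forall j, d 0 j != 0) -> invmx (diag_mx d) = diag_mx (\row_j (d 0 j)^-1).
Proof.
move=> d_neq0.
have dV : diag_mx d *m diag_mx (\row_j (d 0 j)^-1) = 1%:M.
  by rewrite mulmx_diag -diag_const_mx; congr diag_mx; apply/rowP => j;
    rewrite !mxE mulfV.
have [d_unit _] := mulmx1_unit dV.
by rewrite -[RHS](mulKmx d_unit) dV mulmx1.
Qed.

End MatrixNorms.

(** * Both norm bounds, from the coordinate inequality divided by two different scales *)

Theorem lemma2p2 (R : realType) (n p : nat)
    (X : 'M[R]_(n, p)) (beta0 : 'cV[R]_p) (eps Y : 'cV[R]_n)
    (lambda lambda0 lambda_eps : R)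
    (beta_hat : 'cV[R]_p) (gamma_hat : 'I_p -> 'cV[R]_p.-1)
    (model : Y = X *m beta0 + eps)
    (lambda_gt0 : 0 < lambda) (lambda0_gt0 : 0 < lambda0)
    (lambda_eps_ge0 : 0 <= lambda_eps)
    (beta_hat_lasso : is_lasso X Y lambda beta_hat)
    (gamma_hat_sqrt_lasso : forall j, is_sqrt_lasso X lambda0 j (gamma_hat j))
    (tau_hat_gt0 : forall j, 0 < tau_hat X gamma_hat j) :
  let C := C_hat gamma_hat in
  let Theta := Theta_hat X gamma_hat lambda0 in
  let That := T_hat X gamma_hat in
  let Ttilde := T_tilde X gamma_hat lambda0 in
  mx_norm (eps^T *m X *m C *m invmx That) / n%:R <= lambda_eps ->
  mx_norm (beta_hat - beta0)
    <= (lambda_eps + lambda0 * l1norm (beta_hat - beta0))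
         * mx_norm (invmx (Ttilde *m Ttilde) *m That)
       + lambda * max_col_l1norm Theta
  /\
  mx_norm (invmx That *m (Ttilde *m Ttilde) *m (beta_hat - beta0))
    <= lambda_eps + lambda0 * l1norm (beta_hat - beta0)
       + lambda * max_col_l1norm (C *m invmx That).
Proof.
move=> C Theta That Ttilde event.
set D := beta_hat - beta0.
pose tau := tau_hat X gamma_hat; pose tt := tau_tilde_sq X gamma_hat lambda0.
have tau0 j : 0 < tau j := tau_hat_gt0 j.
have tt0 j : 0 < tt j by apply: tau_tilde_sq_gt0 => //; exact: ltW.
have ThatV : invmx That = diag_mx (\row_j (tau j)^-1).
  rewrite invmx_diag_mx => [|j]; last by rewrite mxE gt_eqF.
  by congr diag_mx; apply/rowP => j; rewrite !mxE.
have Tt2 : Ttilde *m Ttilde = diag_mx (\row_j tt j).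
  rewrite mulmx_diag; congr diag_mx; apply/rowP => j.
  by rewrite !mxE -expr2 sqr_sqrtr// ltW.
have Tt2V : invmx (Ttilde *m Ttilde) = diag_mx (\row_j (tt j)^-1).
  rewrite Tt2 invmx_diag_mx => [|j]; last by rewrite mxE gt_eqF.
  by congr diag_mx; apply/rowP => j; rewrite !mxE.
have colC j : col j C = c_hat gamma_hat j by apply/colP => k; rewrite !mxE.
(* Up to the factor [tau j], this pairing is entry [j] of the row vector bounded by the event. *)
have noise_le j : `|emp_dot (X *m c_hat gamma_hat j) eps| <= lambda_eps * tau j.
  rewrite -ler_pdivrMr//; apply: le_trans event.
  rewrite emp_dotC /emp_dot mulmxA -colC colE mulmxA -colE.
  rewrite normrM [`|n%:R^-1|]ger0_norm ?invr_ge0// mulrAC.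
  rewrite ler_wpM2r ?invr_ge0//.
  apply: le_trans (le_mx_norm _ _ _ 0 j).
  rewrite ThatV mul_mx_diag [in leRHS]mxE normrM [(\row_k (tau k)^-1) _ _]mxE.
  by rewrite [`|(tau j)^-1|]gtr0_norm ?invr_gt0// mxE.
(* Since [lambda_node] is [lambda0 * tau j], the noise and bias terms share the factor [tau j]. *)
have main j : tt j * `|D j 0| <=
    (lambda_eps + lambda0 * l1norm D) * tau j + lambda * l1norm (c_hat gamma_hat j).
  apply: le_trans (lasso_error_coord _ _ _ _ (ltW lambda0_gt0)
    (gamma_hat_sqrt_lasso j) _ _ _ _ _ model (ltW lambda_gt0) beta_hat_lasso) _.
  rewrite lerD2r mulrDl lerD// mulrAC; exact: lexx.
have l0D : 0 <= lambda_eps + lambda0 * l1norm D.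
  by rewrite addr_ge0// mulr_ge0 ?l1norm_ge0// ltW.
split.
- apply: mx_norm_le => [|j i].
    by rewrite addr_ge0 ?mulr_ge0 ?mx_norm_ge0 ?max_col_l1norm_ge0// ltW.
  rewrite (ord1 i).
  (* Dividing by [tt j] produces the [j]-th diagonal entry of the weight matrix and the l1 norm of
     column [j] of [Theta]. *)
  have : `|D j 0| <= (lambda_eps + lambda0 * l1norm D) * ((tt j)^-1 * tau j)
                     + lambda * ((tt j)^-1 * l1norm (c_hat gamma_hat j)).
    rewrite !(mulrCA _ (tt j)^-1) -mulrDr mulrC ler_pdivlMr//.
    by rewrite mulrC; exact: main.
  move/le_trans; apply; apply: lerD; [apply: ler_wpM2l => //|rewrite ler_pM2l//].
  + apply: le_trans (le_mx_norm _ _ _ j j).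
    rewrite Tt2V mulmx_diag !mxE eqxx mulr1n.
    exact: ler_norm.
  + apply: le_trans (le_max_col_l1norm _ _ _ j).
    rewrite -[(tt j)^-1]gtr0_norm ?invr_gt0// -l1normZ.
    rewrite (_ : col j Theta = (tt j)^-1 *: c_hat gamma_hat j)//.
    by apply/colP => k; rewrite !mxE.
- apply: mx_norm_le => [|j i].
    by rewrite !addr_ge0 ?mulr_ge0 ?l1norm_ge0 ?max_col_l1norm_ge0// ltW.
  rewrite (ord1 i) ThatV Tt2 mulmx_diag mul_diag_mx [X in `|X|]mxE.
  rewrite [(\row_k _) _ _]mxE [X in X * _ * _]mxE [X in _ * X * _]mxE.
  (* Here [main] is divided by [tau j] instead, which leaves the l1 norm of column [j] of
     [C *m invmx That]. *)
  rewrite normrM gtr0_norm ?mulr_gt0 ?invr_gt0// -mulrA ler_pdivrMl//.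
  apply: le_trans (main j) _; rewrite mulrDr mulrC lerD2l mulrCA.
  rewrite ler_pM2l// -ler_pdivrMl//.
  apply: le_trans (le_max_col_l1norm _ _ _ j).
  rewrite -[(tau j)^-1]gtr0_norm ?invr_gt0// -l1normZ.
  rewrite (_ : col j (C *m _) = (tau j)^-1 *: c_hat gamma_hat j)//.
  by apply/colP => k; rewrite mul_mx_diag !mxE mulrC.
Qed.
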